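(* Let $V$ be a vector space, $(V,\vdash,[\cdot,\cdot])$ a Perm-Leibniz algebra, and $R=\mathbb{C}[\partial]V$ the corresponding quadratic Leibniz conformal algebra. Let $\widehat{R}=R\oplus\mathbb{C}\mathfrak{c}$ be a central extension of $R$ by a one-dimensional center $\mathbb{C}\mathfrak{c}$, with $\lambda$-product $$\widetilde{[a_\lambda b]}=\partial(a\vdash b)+2\lambda(a\vdash b)+[a,b]+\alpha_\lambda(a,b)\mathfrak{c},\qquad a,b\in V,$$ where $\alpha_\lambda(a,b)\in\mathbb{C}[\lambda]$. Assume that $\alpha_\lambda(a,b)=\sum_{i=0}^n\lambda^i\alpha_i(a,b)$ for all $a,b\in V$, where $\alpha_i(\cdot,\cdot):V\times V\to\mathbb{C}$ are bilinear forms and there exist $a,b\in V$ with $\alpha_n(a,b)\neq 0$. Then for all $a,b,c\in V$: (1) If $n>3$, then $\alpha_n(a\vdash b,c)=0$. (2) If $n\le 3$, then $\alpha_\lambda(a,b)=\sum_{i=0}^3\lambda^i\alpha_i(a,b)$ (with $\alpha_i=0$ for $i>n$) and $\alpha_\lambda(\cdot,\cdot)$ satisfies $$(\lambda+2\mu)\alpha_\lambda(a,b\vdash c)+\alpha_\lambda(a,[b,c])=(\lambda-\mu)\alpha_{\lambda+\mu}(a\vdash b,c)+\alpha_{\lambda+\mu}([a,b],c)+(2\lambda+\mu)\alpha_\mu(b,a\vdash c)+\alpha_\mu(b,[a,c]).$$ (3) Two such 2-cocycles $\alpha_\lambda(\cdot,\cdot)$ and $\alpha'_\lambda(\cdot,\cdot)$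 are equivalent if and only if there exists a linear map $\varphi:V\to\mathbb{C}$ such that $$\alpha_\lambda(a,b)=\alpha'_\lambda(a,b)+2\lambda\varphi(a\vdash b)+\varphi([a,b])\quad\text{for all }a,b\in V.$$
   Context: All vector spaces are over $\mathbb{C}$. A Leibniz algebra is a vector space with a bilinear operation satisfying $[a,[b,c]]=[[a,b],c]+[b,[a,c]]$. A Perm-Leibniz algebra is a vector space $V$ with bilinear operations $\vdash,[\cdot,\cdot]$ such that $(V,[\cdot,\cdot])$ is a Leibniz algebra and for all $x,y,z\in V$: $x\vdash(y\vdash z)=y\vdash(x\vdash z)=(x\vdash y)\vdash z$; $x\vdash[y,z]+[x,y\vdash z]=y\vdash[x,z]+[y,x\vdash z]+[x,y]\vdash z$; $2x\vdash[y,z]=[y,x\vdash z]+[x\vdash y,z]$; $[x\vdash y-y\vdash x,z]=([x,y]+[y,x])\vdash z$. A conformal algebra is a $\mathbb{C}[\partial]$-module $R$ with a $\mathbb{C}$-bilinear map $R\times R\to R[\lambda]$, $(a,b)\mapsto[a_\lambda b]$, with $[\partial a_\lambda b]=-\lambda[a_\lambda b]$, $[a_\lambda\partial b]=(\partial+\lambda)[a_\lambda b]$. It is a Leibniz conformal algebra if $[a_\lambda[b_\mu c]]=[[a_\lambda b]_{\lambda+\mu}c]+[b_\mu[a_\lambda c]]$. The quadratic Leibniz conformal algebra corresponding to a Perm-Leibniz algebra $(V,\vdash,[\cdot,\cdot])$ is the free $\mathbb{C}[\partial]$-module $R=\mathbb{C}[\partial]V$ with $[a_\lambda b]=\partial(a\vdash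 b)+2\lambda(a\vdash b)+[a,b]$ for $a,b\in V$, extended by sesquilinearity. A central extension $\widehat R=R\oplus\mathbb{C}\mathfrak{c}$ of $R$ by the one-dimensional center $\mathbb{C}\mathfrak{c}$ is a Leibniz conformal algebra with $\partial\mathfrak{c}=0$, $\mathfrak{c}$ central, and $[a_\lambda b]_{\widehat R}=[a_\lambda b]_R+\alpha_\lambda(a,b)\mathfrak{c}$ for $a,b\in R$, where $\alpha_\lambda:R\times R\to\mathbb{C}[\lambda]$ is $\mathbb{C}$-bilinear. Then $\alpha_\lambda$ is a 2-cocycle, i.e. $\alpha_\lambda(\partial a,b)=-\lambda\alpha_\lambda(a,b)=-\alpha_\lambda(a,\partial b)$ and $\alpha_\lambda(a,[b_\mu c])=\alpha_{\lambda+\mu}([a_\lambda b],c)+\alpha_\mu(b,[a_\lambda c])$. Two 2-cocycles $\alpha,\alpha'$ are equivalent if there is a $\mathbb{C}[\partial]$-module homomorphism $\varphi:R\to\mathbb{C}$ (with $\mathbb{C}$ the trivial module, $\partial$ acting by $0$) such that $\alpha_\lambda(a,b)=\alpha'_\lambda(a,b)+\varphi([a_\lambda b])$ for all $a,b\in R$ (where $\varphi$ is extended coefficientwise in $\lambda$). *)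

(* Defs.v *)
From HB Require Import structures.
From mathcomp Require Import all_boot all_order all_algebra sesquilinear.
From mathcomp Require Import boolp functions.

Set Implicit Arguments.
Unset Strict Implicit.
Unset Printing Implicit Defensive.

Import GRing.Theory.
Local Open Scope ring_scope.

(* The F-vector space M[X] of polynomials with coefficients in a vector space
   M, as finitely supported sequences.  It serves at the same time as the
   free F[∂]-module F[∂]M (with ∂ acting as X), as M[λ], and, iterated, as
   M[λ, μ]; {poly M} is not available because M is not a ring. *)
Section VPoly.
Variables (F : fieldType) (M : lmodType F).

Definition fin_supp : {pred nat -> M} :=
  [pred f | `[< exists N, forall n, (N <= n)%N -> f n = 0 >]].

Lemma fin_suppP (f : nat -> M) :
  reflect (exists N, forall n, (N <= n)%N -> f n = 0) (f \in fin_supp).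
Proof. exact: asboolP. Qed.

Fact fin_supp_submod_closed : submod_closed fin_supp.
Proof.
split=> [|a f g /fin_suppP[N fN] /fin_suppP[K gK]]; apply/fin_suppP.
  by exists 0.
exists (maxn N K) => n; rewrite geq_max => /andP[Nn Kn].
by rewrite !fctE /= fN// gK// scaler0 addr0.
Qed.
HB.instance Definition _ :=
  GRing.isSubmodClosed.Build F (nat -> M) fin_supp fin_supp_submod_closed.

Record vpoly := VPoly { vcoef :> nat -> M; _ : vcoef \in fin_supp }.
HB.instance Definition _ := [isSub for vcoef].
HB.instance Definition _ := [Choice of vpoly by <:].
HB.instance Definition _ := [SubChoice_isSubLmodule of vpoly by <:].

Fact vconst_subproof (m : M) : (fun i => if i == 0 then m else 0) \in fin_supp.
Proof. by apply/fin_suppP; exists 1; case. Qed.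
Definition vconst (m : M) : vpoly := VPoly (vconst_subproof m).

Fact vshift_subproof (p : vpoly) :
  (fun i => if i is j.+1 then p j else 0) \in fin_supp.
Proof.
case: p => f /= /fin_suppP[N fN]; apply/fin_suppP; exists N.+1.
by case=> // n; apply: fN.
Qed.
(* multiplication by the indeterminate *)
Definition vshift (p : vpoly) : vpoly := VPoly (vshift_subproof p).

Fact vsize_subproof (p : vpoly) :
  exists N, `[< forall n, (N <= n)%N -> p n = 0 >].
Proof.
by case: p => f /= /fin_suppP[N fN]; exists N; apply/asboolP.
Qed.
(* degree + 1, and 0 for the zero polynomial *)
Definition vsize (p : vpoly) : nat := ex_minn (vsize_subproof p).

End VPoly.

(* For p = \sum_i m_i X^i, [vsubst f T p] is \sum_i T^i (f m_i): the value
   obtained by applying f to the coefficients and letting X act as T. *)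
Definition vsubst (F : fieldType) (M : lmodType F) (N : zmodType)
    (f : M -> N) (T : N -> N) (p : vpoly M) : N :=
  \sum_(i < vsize p) iter i T (f (p i)).

Definition vmap (F : fieldType) (M N : lmodType F) (f : M -> N)
    (p : vpoly M) : vpoly N :=
  vsubst (fun m => vconst (f m)) (@vshift F N) p.

Section Conformal.
Variable F : fieldType.

Definition is_leibniz (V : lmodType F) (br : V -> V -> V) : Prop :=
  forall a b c, br a (br b c) = br (br a b) c + br b (br a c).

Record is_perm_leibniz (V : lmodType F) (vd br : V -> V -> V) : Prop := {
  pl_vd_bilin : bilinear_for *:%R *:%R vd;
  pl_br_bilin : bilinear_for *:%R *:%R br;
  pl_leibniz : is_leibniz br;
  pl_vd_perm : forall x y z, vd x (vd y z) = vd y (vd x z);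
  pl_vd_assoc : forall x y z, vd y (vd x z) = vd (vd x y) z;
  pl_compat1 : forall x y z,
    vd x (br y z) + br x (vd y z)
    = vd y (br x z) + br y (vd x z) + vd (br x y) z;
  pl_compat2 : forall x y z,
    2 *: vd x (br y z) = br y (vd x z) + br (vd x y) z;
  pl_compat3 : forall x y z,
    br (vd x y - vd y x) z = vd (br x y + br y x) z }.

(* A conformal algebra: an F[∂]-module R, given as a vector space with the
   endomorphism d by which ∂ acts, and a λ-bracket with values in
   R[λ] = vpoly R. *)
Record is_conformal (R : lmodType F) (d : R -> R) (br : R -> R -> vpoly R)
    : Prop := {
  ca_d_linear : linear d;
  ca_bilin : bilinear_for *:%R *:%R br;
  ca_sesqui_l : forall a b, br (d a) b = - vshift (br a b);
  ca_sesqui_r : forall a b, br a (d b) = vmap d (br a b) + vshift (br a b) }.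

(* R[λ, μ], as (R[λ])[μ]. *)
Definition vpoly2 (R : lmodType F) : lmodType F := vpoly (vpoly R).
Definition vlam (R : lmodType F) : vpoly2 R -> vpoly2 R := vmap (@vshift F R).
Definition vmu (R : lmodType F) : vpoly2 R -> vpoly2 R := @vshift F (vpoly R).

(* [a_T b] in R[λ, μ], where T is (the action of) λ, μ or λ + μ. *)
Definition br_at (R : lmodType F) (br : R -> R -> vpoly R)
    (T : vpoly2 R -> vpoly2 R) (a b : R) : vpoly2 R :=
  vsubst (fun r => vconst (vconst r)) T (br a b).

(* [a_λ [b_μ c]] = [[a_λ b]_{λ+μ} c] + [b_μ [a_λ c]] in R[λ, μ]; the outer
   bracket is extended linearly over F[λ, μ]. *)
Definition conformal_jacobi (R : lmodType F) (br : R -> R -> vpoly R) : Prop :=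
  forall a b c,
    vsubst (fun r => br_at br (@vlam R) a r) (@vmu R) (br b c)
    = vsubst (fun r => br_at br (@vlam R \+ @vmu R) r c) (@vlam R) (br a b)
      + vsubst (fun r => br_at br (@vmu R) b r) (@vlam R) (br a c).

Definition is_leibniz_conformal (R : lmodType F) (d : R -> R)
    (br : R -> R -> vpoly R) : Prop :=
  is_conformal d br /\ conformal_jacobi br.

(* The quadratic Leibniz conformal algebra: R = F[∂]V is vpoly V, with V
   embedded by vconst and ∂ acting as vshift. *)
Section Quadratic.
Variables (V : lmodType F) (vd br : V -> V -> V).

(* [a_λ b] = ∂(a ⊢ b) + 2λ(a ⊢ b) + [a, b] for a, b in V *)
Definition quad_base (a b : V) : vpoly (vpoly V) :=
  vconst (vshift (vconst (vd a b)))
  + 2 *: vshift (vconst (vconst (vd a b)))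
  + vconst (vconst (br a b)).

(* [(\sum_i ∂^i a_i)_λ (\sum_j ∂^j b_j)]
   = \sum_(i, j) (-λ)^i (∂ + λ)^j [a_i _λ b_j] *)
Definition quad_br (f g : vpoly V) : vpoly (vpoly V) :=
  vsubst
    (fun a => vsubst (quad_base a) (vmap (@vshift F V) \+ @vshift F (vpoly V)) g)
    (fun p => - vshift p) f.

End Quadratic.

(* The candidate R ⊕ F𝔠, with [a_λ b] + α_λ(a, b)𝔠: here (r, z) is r + z𝔠,
   ∂𝔠 = 0 and 𝔠 is central. *)
Section Extension.
Variables (R : lmodType F) (d : R -> R) (br : R -> R -> vpoly R).
Variable alpha : R -> R -> {poly F}.

Definition ext_d (u : (R * F^o)%type) : (R * F^o)%type := (d u.1, 0).

Definition ext_br (u v : (R * F^o)%type) : vpoly (R * F^o)%type :=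
  vmap (fun r : R => (r, 0 : F^o)) (br u.1 v.1)
  + \sum_(i < size (alpha u.1 v.1))
      iter i (@vshift _ _) (vconst (0, (alpha u.1 v.1)`_i : F^o)).

Definition is_central_extension : Prop :=
  bilinear_for *:%R *:%R alpha /\ is_leibniz_conformal ext_d ext_br.

End Extension.

(* Equivalence of 2-cocycles; φ is a homomorphism to the trivial
   F[∂]-module F, applied to the coefficients of [a_λ b]. *)
Definition cocycle_equiv (R : lmodType F) (d : R -> R) (br : R -> R -> vpoly R)
    (alpha alpha' : R -> R -> {poly F}) : Prop :=
  exists phi : R -> F,
    [/\ scalar phi, (forall r, phi (d r) = 0) &
      forall a b, alpha a b
        = alpha' a b + vsubst (fun r => (phi r)%:P) (fun p => 'X * p) (br a b)].

(* Two-variable scalars: F[λ, μ] is {poly {poly F}} with λ = 'X%:P and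
   μ = 'X; [poly_at p t] is p(t) in F[λ, μ]. *)
Definition poly_at (p : {poly F}) (t : {poly {poly F}}) : {poly {poly F}} :=
  p^:P \Po t.

End Conformal.

(* Main.v *)
Require Import Defs.
From HB Require Import structures.
From mathcomp Require Import all_boot all_order all_algebra sesquilinear.
From mathcomp Require Import reals complex.
From mathcomp Require Import ring boolp functions.

Set Implicit Arguments.
Unset Strict Implicit.
Unset Printing Implicit Defensive.

Import GRing.Theory.
Local Open Scope ring_scope.
Local Open Scope complex_scope.

(** The whole theorem comes from reading off the coefficient of the central
    element in the axioms of the extension.  The bracket of the extension takes
    values in M[λ] and M[λ, μ] with M = R ⊕ F𝔠; every additive chi : M -> F
    induces maps M[λ] -> F[λ] and M[λ, μ] -> F[λ, μ] ([vev], [vev2]) that are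
    linear over the indeterminates.  Taking for chi the coordinate along 𝔠
    turns the Jacobi identity into the 2-cocycle identity for alpha
    ([ext_cocycle]), and the sesquilinearity of the bracket into
    alpha(∂a, b) = - λ alpha(a, b) and alpha(a, ∂b) = λ alpha(a, b)
    ([cocycle_sesquiform]).

    On constants a, b, c : V the bracket is the explicit polynomial
    ∂(a ⊢ b) + 2λ(a ⊢ b) + [a, b], and sesquilinearity eliminates ∂: this gives
    the functional equation of part (2) ([quad_cocycle]), whatever the degree n.

    Part (1) compares two coefficients of this equation, with A = alpha_n.  In
    λ^(n+1) it says A(a, b ⊢ c) = A(a ⊢ b, c), and in λ^n μ it says
    2 A(a, b ⊢ c) = (n - 1) A(a ⊢ b, c).  Therefore (n - 3) A(a ⊢ b, c) = 0
    ([coef_cocycle_top]).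

    For part (3), sesquilinear forms on F[∂]V are determined by their values on
    V ([sesquiform_eq]).  Both alpha and alpha' + phi([a_λ b]) are sesquilinear
    when phi kills the image of ∂, and on V the coboundary phi([a_λ b]) is
    2λ phi(a ⊢ b) + phi([a, b]).  The F[∂]-morphisms F[∂]V -> F are exactly the
    linear maps on V composed with the constant coefficient, so that the two
    notions of equivalence agree ([quad_cocycle_equivP]). *)

(** * Additive maps *)

(* Most additive maps below are anonymous compositions, for which a proof of
   additivity is easier to carry around than a bundled morphism. *)
Section ZmodMorphism.
Variables (U W : zmodType) (f : U -> W).
Hypothesis fB : zmod_morphism f.

Lemma zmod_morphism0 : f 0 = 0.
Proof. by rewrite -(subrr 0) fB subrr. Qed.

Lemma zmod_morphismN : {morph f : x / - x}.
Proof. by move=> x; rewrite -sub0r fB zmod_morphism0 sub0r. Qed.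

Lemma zmod_morphismD : {morph f : x y / x + y}.
Proof. by move=> x y; rewrite -{1}[y]opprK fB zmod_morphismN opprK. Qed.

Lemma zmod_morphism_sum (I : Type) (r : seq I) (P : pred I) (E : I -> U) :
  f (\sum_(i <- r | P i) E i) = \sum_(i <- r | P i) f (E i).
Proof. exact: (big_morph f zmod_morphismD zmod_morphism0). Qed.
End ZmodMorphism.

(** * Polynomials with coefficients in a vector space *)

Section VPolyTheory.
Variables (F : fieldType) (M : lmodType F).
Implicit Types p q : vpoly M.

Lemma vpolyP p q : (forall i, p i = q i) -> p = q.
Proof. by move=> pq; apply/val_inj/funext. Qed.

Lemma vcoefD p q i : (p + q) i = p i + q i.
Proof. by []. Qed.

Lemma vcoefB p q i : (p - q) i = p i - q i.
Proof. by []. Qed.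

Lemma vconst_linear : linear (@vconst F M).
Proof.
move=> k x y; apply: vpolyP => -[|i] //.
by rewrite -[RHS]/(k *: 0 + 0) scaler0 addr0.
Qed.
HB.instance Definition _ :=
  GRing.isLinear.Build F M (vpoly M) *:%R (@vconst F M) vconst_linear.

Lemma vshiftB : zmod_morphism (@vshift F M).
Proof. by move=> x y; apply: vpolyP => -[|i]; rewrite vcoefB ?subrr. Qed.
HB.instance Definition _ :=
  GRing.isZmodMorphism.Build (vpoly M) (vpoly M) (@vshift F M) vshiftB.

Lemma vcoef_out p i : (vsize p <= i)%N -> p i = 0.
Proof.
rewrite /vsize; case: ex_minnP => N /asboolP pN _; exact: pN.
Qed.

Lemma vsize_le p N : (forall i, (N <= i)%N -> p i = 0) -> (vsize p <= N)%N.
Proof.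
by move=> pN; rewrite /vsize; case: ex_minnP => k _; apply; apply/asboolP.
Qed.

(** F[∂]M is generated by M under addition and the action of ∂, which is how
    sesquilinear identities propagate from constants. *)
Lemma vpoly_ind (P : vpoly M -> Prop) :
  (forall m, P (vconst m)) -> (forall p, P p -> P (vshift p)) ->
  (forall p q, P p -> P q -> P (p + q)) -> forall p, P p.
Proof.
move=> Pc Ps Pa p; have [N] := ubnP (vsize p).
elim: N p => // N IH p pN.
(* Horner decomposition: p is its constant term plus ∂ times a shorter tail. *)
have tail_supp : (fun i => p i.+1) \in fin_supp (M := M).
  apply/fin_suppP; exists (vsize p) => n pn.
  by apply: vcoef_out; apply: leqW.
have -> : p = vconst (p 0%N) + vshift (VPoly tail_supp).
  by apply: vpolyP => -[|i]; rewrite vcoefD /= ?addr0 ?add0r.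
case: N IH pN => [_|N IH pN].
  rewrite ltnS leqn0 => /eqP p0.
  have -> : VPoly tail_supp = vconst 0.
    by apply: vpolyP => -[|i] /=; apply: (vcoef_out (p := p)); rewrite p0.
  by apply: Pa => //; apply: Ps.
apply: Pa => //; apply/Ps/IH; rewrite ltnS.
apply: vsize_le => i iN; apply: (vcoef_out (p := p)).
exact: leq_trans (pN : (vsize p <= N.+1)%N) _.
Qed.

Section Subst.
Variables (N : zmodType).
Implicit Types (f : M -> N) (T : N -> N).

Lemma iterB T i : zmod_morphism T -> zmod_morphism (iter i T).
Proof. by move=> TB x y; elim: i => //= i ->; apply: TB. Qed.

Lemma iter_fix0 T i : T 0 = 0 -> iter i T 0 = 0.
Proof. by move=> T0; elim: i => //= i ->. Qed.

Lemma eq_vsubst f f' T T' :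
  f =1 f' -> T =1 T' -> vsubst f T =1 vsubst f' T'.
Proof. by move=> /funext-> /funext->. Qed.

(** The size of a sum is not determined by the sizes of its terms, so additivity
    needs a summation range that is common to several polynomials. *)
Lemma vsubst_wide f T p k : f 0 = 0 -> T 0 = 0 -> (vsize p <= k)%N ->
  vsubst f T p = \sum_(i < k) iter i T (f (p i)).
Proof.
move=> f0 T0 pk; rewrite /vsubst (big_ord_widen k (fun i => iter i T (f (p i))))//.
rewrite [RHS](bigID (fun i : 'I_k => i < vsize p)%N) /= [X in _ = _ + X]big1 ?addr0//.
by move=> i; rewrite -leqNgt => /vcoef_out ->; rewrite f0 iter_fix0.
Qed.

Lemma vsubst_const f T m : f 0 = 0 -> T 0 = 0 -> vsubst f T (vconst m) = f m.
Proof.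
by move=> f0 T0; rewrite (@vsubst_wide _ _ _ 1) ?big_ord1//; apply: vsize_le; case.
Qed.

Lemma vsubst_shift f T p : zmod_morphism f -> zmod_morphism T ->
  vsubst f T (vshift p) = T (vsubst f T p).
Proof.
move=> fB TB; have f0 := zmod_morphism0 fB; have T0 := zmod_morphism0 TB.
rewrite (@vsubst_wide _ _ _ (vsize p).+1)//; last first.
  by apply: vsize_le => -[|i]//=; apply: vcoef_out.
rewrite big_ord_recl /= f0 add0r.
by rewrite /vsubst zmod_morphism_sum.
Qed.

Lemma vsubst_iter_shift f T i p : zmod_morphism f -> zmod_morphism T ->
  vsubst f T (iter i (@vshift F M) p) = iter i T (vsubst f T p).
Proof. by move=> fB TB; elim: i => //= i <-; apply: vsubst_shift. Qed.

Lemma vsubstB f T : zmod_morphism f -> zmod_morphism T -> zmod_morphism (vsubst f T).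
Proof.
move=> fB TB p q; have f0 := zmod_morphism0 fB; have T0 := zmod_morphism0 TB.
pose k := maxn (vsize (p - q)) (maxn (vsize p) (vsize q)).
rewrite !(@vsubst_wide _ _ _ k) ?leq_max ?leqnn ?orbT//.
by rewrite -sumrB; apply: eq_bigr => i _; rewrite vcoefB fB iterB.
Qed.

(** An additive map that turns the action T of the indeterminate into S can be
    pushed inside a substitution.  All changes of coefficients below are
    instances of this. *)
Lemma vsubst_fuse (L : zmodType) (g : N -> L) f T S p : zmod_morphism g ->
  (forall x, g (T x) = S (g x)) -> g (vsubst f T p) = vsubst (g \o f) S p.
Proof.
move=> gB gT.
rewrite /vsubst zmod_morphism_sum//; apply: eq_bigr => i _ /=.
by elim: (val i) (f (p i)) => //= j IH x; rewrite gT IH.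
Qed.

End Subst.
End VPolyTheory.
Arguments vsubst_fuse {F M N L g f T} S {p}.

Section VMap.
Variables (F : fieldType) (M N : lmodType F) (f : M -> N).
Hypothesis fB : zmod_morphism f.

Lemma vmapB : zmod_morphism (vmap f).
Proof. by apply: vsubstB => x y; rewrite ?fB raddfB. Qed.

Lemma vsubst_vmap (L : zmodType) (g : N -> L) (T : L -> L) p :
  zmod_morphism g -> zmod_morphism T ->
  vsubst g T (vmap f p) = vsubst (g \o f) T p.
Proof.
move=> gB TB; rewrite (vsubst_fuse T)//.
- by apply: eq_vsubst => // m /=; rewrite vsubst_const// zmod_morphism0.
- exact: vsubstB.
- by move=> x; rewrite vsubst_shift.
Qed.
End VMap.

Section PolyAt.
Variable F : fieldType.
Implicit Types (p q : {poly F}) (t : {poly {poly F}}).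

Lemma poly_atB t : zmod_morphism (fun p => poly_at p t).
Proof. by move=> p q; rewrite /poly_at rmorphB/= comp_polyB. Qed.

Lemma poly_atXM t p : poly_at ('X * p) t = t * poly_at p t.
Proof. by rewrite /poly_at rmorphM/= comp_polyM map_polyX comp_polyX. Qed.

Lemma poly_atC t c : poly_at c%:P t = c%:P%:P.
Proof. by rewrite /poly_at map_polyC comp_polyC. Qed.

End PolyAt.

Lemma mulr_zmod (R : pzRingType) (x : R) : zmod_morphism ( *%R x).
Proof. exact: mulrBr. Qed.

(** * Evaluating coefficients in a conformal algebra *)

(* [vev] and [vev2] are the maps M[λ] -> F[λ] and M[λ, μ] -> F[λ, μ] induced by
   chi.  They are additive and intertwine the action of the indeterminates with
   multiplication, so they carry the axioms of a conformal algebra over to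
   identities between ordinary polynomials. *)
Section Evaluation.
Variables (F : fieldType) (M : lmodType F) (chi : M -> F).
Hypothesis chiB : zmod_morphism chi.

Definition vev (p : vpoly M) : {poly F} :=
  vsubst (fun m => (chi m)%:P) (fun q => 'X * q) p.

Definition vev2 (P : vpoly2 M) : {poly {poly F}} :=
  vsubst (fun q => (vev q)%:P) (fun q => 'X * q) P.

Lemma vevB : zmod_morphism vev.
Proof. by apply: vsubstB => x y; rewrite ?mulrBr// chiB raddfB. Qed.

Lemma vev_const m : vev (vconst m) = (chi m)%:P.
Proof. by rewrite /vev vsubst_const ?mulr0// zmod_morphism0. Qed.

Lemma vev_shift p : vev (vshift p) = 'X * vev p.
Proof. by rewrite /vev vsubst_shift// => x y; rewrite ?mulrBr// chiB raddfB. Qed.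

Let polyC_vevB : zmod_morphism (fun q => (vev q)%:P).
Proof. by move=> x y; rewrite vevB raddfB. Qed.

Lemma vev2B : zmod_morphism vev2.
Proof. by apply: vsubstB => //; apply: mulr_zmod. Qed.

Lemma vev2_mu P : vev2 (vmu P) = 'X * vev2 P.
Proof. by rewrite /vev2 vsubst_shift//; apply: mulr_zmod. Qed.

Lemma vev2_lam P : vev2 (vlam P) = 'X%:P * vev2 P.
Proof.
rewrite /vev2 /vlam vsubst_vmap; [|exact: polyC_vevB|exact: mulr_zmod].
rewrite [RHS](vsubst_fuse (g := *%R 'X%:P) ( *%R 'X)).
- by apply: eq_vsubst => // q /=; rewrite vev_shift polyCM.
- exact: mulr_zmod.
- by move=> x; rewrite mulrCA.
Qed.

Lemma vev2_vsubst (T : vpoly2 M -> vpoly2 M) t (L : lmodType F) (f : L -> vpoly2 M) p :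
  (forall P, vev2 (T P) = t * vev2 P) ->
  vev2 (vsubst f T p) = vsubst (fun x => vev2 (f x)) ( *%R t) p.
Proof. by move=> TP; rewrite (vsubst_fuse ( *%R t))//; apply: vev2B. Qed.

(** The hypothesis on T holds for λ, μ and λ + μ; so the three occurrences of
    a shifted bracket in the Jacobi identity become evaluations of the
    polynomial [vev (br a b)]. *)
Lemma vev2_br_at (br : M -> M -> vpoly M) (T : vpoly2 M -> vpoly2 M) t a b :
  (forall P, vev2 (T P) = t * vev2 P) ->
  vev2 (br_at br T a b) = poly_at (vev (br a b)) t.
Proof.
move=> TP; rewrite /br_at (vev2_vsubst _ _ TP) /vev.
rewrite (vsubst_fuse (g := fun p => poly_at p t) ( *%R t)).
- apply: eq_vsubst => // m /=.
  rewrite /vev2 vsubst_const ?vev_const ?poly_atC ?mulr0//.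
  by rewrite zmod_morphism0//; apply: vevB.
- exact: poly_atB.
- exact: poly_atXM.
Qed.

Lemma vev2_jacobi (br : M -> M -> vpoly M) : conformal_jacobi br ->
  forall a b c,
  vsubst (fun r => poly_at (vev (br a r)) 'X%:P) ( *%R 'X) (br b c)
  = vsubst (fun r => poly_at (vev (br r c)) ('X%:P + 'X)) ( *%R 'X%:P) (br a b)
    + vsubst (fun r => poly_at (vev (br b r)) 'X) ( *%R 'X%:P) (br a c).
Proof.
move=> jac a b c; have := congr1 vev2 (jac a b c).
have addP P : vev2 ((@vlam F M \+ @vmu F M) P) = ('X%:P + 'X) * vev2 P.
  by rewrite /= (zmod_morphismD vev2B) vev2_lam vev2_mu mulrDl.
rewrite (zmod_morphismD vev2B) (vev2_vsubst _ _ vev2_mu) !(vev2_vsubst _ _ vev2_lam).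
rewrite (eq_vsubst (fun r => vev2_br_at br a r vev2_lam) (frefl _)).
rewrite (eq_vsubst (fun r => vev2_br_at br r c addP) (frefl _)).
by rewrite (eq_vsubst (fun r => vev2_br_at br b r vev2_mu) (frefl _)).
Qed.

Lemma vev_sesqui_l (d : M -> M) (br : M -> M -> vpoly M) a b :
  is_conformal d br -> vev (br (d a) b) = - ('X * vev (br a b)).
Proof.
move=> [_ _ sl _]; rewrite sl -[- vshift _]add0r vevB vev_shift.
by rewrite zmod_morphism0 ?sub0r//; apply: vevB.
Qed.

(** The bracket satisfies [a_λ ∂b] = (∂ + λ)[a_λ b]; a functional that kills the
    image of ∂ only sees the term in λ. *)
Lemma vev_sesqui_r (d : M -> M) (br : M -> M -> vpoly M) a b :
  (forall m, chi (d m) = 0) ->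
  is_conformal d br -> vev (br a (d b)) = 'X * vev (br a b).
Proof.
move=> chid [_ _ _ sr]; rewrite sr (zmod_morphismD vevB) vev_shift.
rewrite {1}/vev vsubst_vmap; last exact: mulr_zmod; last first.
  by move=> x y; rewrite chiB raddfB.
rewrite [X in X + _](_ : _ = 0) ?add0r// /vsubst big1// => i _ /=.
by rewrite chid; elim: (val i) => //= j ->; rewrite mulr0.
Qed.

End Evaluation.

(** * Sesquilinear forms *)

(** Forms F[∂]V x F[∂]V -> F[λ] on which ∂ acts as - λ on the left and as λ on
    the right: F[λ] stands for the trivial module F, so the action of ∂ on the
    values is zero. *)
Record sesquiform (F : fieldType) (V : lmodType F)
    (beta : vpoly V -> vpoly V -> {poly F}) : Prop := {
  sesqui_addl : forall a a' b, beta (a + a') b = beta a b + beta a' b;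
  sesqui_addr : forall a b b', beta a (b + b') = beta a b + beta a b';
  sesqui_shiftl : forall a b, beta (vshift a) b = - ('X * beta a b);
  sesqui_shiftr : forall a b, beta a (vshift b) = 'X * beta a b }.

Lemma sesquiform_eq (F : fieldType) (V : lmodType F)
    (beta gamma : vpoly V -> vpoly V -> {poly F}) :
  sesquiform beta -> sesquiform gamma ->
  (forall x y, beta (vconst x) (vconst y) = gamma (vconst x) (vconst y)) ->
  forall a b, beta a b = gamma a b.
Proof.
move=> [bDl bDr bsl bsr] [cDl cDr csl csr] bc a b.
elim/vpoly_ind: a => [x|a IH|a a' IH IH'].
- elim/vpoly_ind: b => [y|b IH|b b' IH IH']; first exact: bc.
    by rewrite bsr csr IH.
  by rewrite bDr cDr IH IH'.
- by rewrite bsl csl IH.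
- by rewrite bDl cDl IH IH'.
Qed.

Lemma sesquiformD (F : fieldType) (V : lmodType F)
    (beta gamma : vpoly V -> vpoly V -> {poly F}) :
  sesquiform beta -> sesquiform gamma ->
  sesquiform (fun a b => beta a b + gamma a b).
Proof.
move=> [bDl bDr bsl bsr] [cDl cDr csl csr]; split=> *.
- by rewrite bDl cDl addrACA.
- by rewrite bDr cDr addrACA.
- by rewrite bsl csl -opprD -mulrDr.
- by rewrite bsr csr -mulrDr.
Qed.

(** * Central extensions *)

Definition central_part (F : fieldType) (R : lmodType F) (w : R * F^o) : F := w.2.

Lemma central_partB (F : fieldType) (R : lmodType F) : zmod_morphism (@central_part F R).
Proof. by []. Qed.

Section CentralExtension.
Variables (F : fieldType) (R : lmodType F) (d : R -> R) (br : R -> R -> vpoly R).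
Variable alpha : R -> R -> {poly F}.
Hypothesis ext : is_central_extension d br alpha.

Lemma central_ext_addl b : zmod_morphism (alpha ^~ b).
Proof. by case: ext => -[al _] _; apply: zmod_morphism_linear. Qed.

Lemma central_ext_addr a : zmod_morphism (alpha a).
Proof. by case: ext => -[_ ar] _; apply: zmod_morphism_linear. Qed.

(** Functions of the R-component do not see the cocycle term of the bracket;
    centrality of 𝔠 enters the cocycle identity through this lemma. *)
Lemma vsubst_ext_fst (N : zmodType) (h : R -> N) (S : N -> N) u v :
  zmod_morphism h -> zmod_morphism S ->
  vsubst (fun w : R * F^o => h w.1) S (ext_br br alpha u v)
  = vsubst h S (br u.1 v.1).
Proof.
move=> hB SB.
have h1B : zmod_morphism (fun w : R * F^o => h w.1) by move=> x y; rewrite hB.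
rewrite /ext_br (zmod_morphismD (vsubstB h1B SB)) vsubst_vmap//.
rewrite (zmod_morphism_sum (vsubstB h1B SB)) big1 ?addr0// => i _.
have h0 := zmod_morphism0 hB; have S0 := zmod_morphism0 SB.
by rewrite vsubst_iter_shift// vsubst_const//= h0 iter_fix0.
Qed.

Lemma vev_ext_snd u v :
  vev (@central_part F R) (ext_br br alpha u v) = alpha u.1 v.1.
Proof.
have sB := @central_partB F R.
have vsB := vevB sB.
have fst0 p : vev (@central_part F R) (vmap (fun r : R => (r, 0 : F^o)) p) = 0.
  rewrite /vev vsubst_vmap; last exact: mulr_zmod; last first.
    by move=> x y; rewrite sB raddfB.
  by rewrite /vsubst big1// => i _ /=; rewrite iter_fix0 ?mulr0.
rewrite /ext_br (zmod_morphismD vsB) fst0 add0r (zmod_morphism_sum vsB).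
rewrite -[RHS]coefK poly_def; apply: eq_bigr => i _.
rewrite /vev vsubst_iter_shift; last exact: mulr_zmod; last first.
  by move=> x y; rewrite sB raddfB.
by rewrite vsubst_const ?mulr0//= iter_mulr mulrC mul_polyC.
Qed.

(** The 2-cocycle identity
    alpha_λ(a, [b_μ c]) = alpha_(λ+μ)([a_λ b], c) + alpha_μ(b, [a_λ c]).
    It is the coordinate along 𝔠 of the Jacobi identity: in every term the outer
    bracket of the extension contributes alpha, while the inner bracket only
    matters through its component in R. *)
Lemma ext_cocycle a b c :
  vsubst (fun r => poly_at (alpha a r) 'X%:P) ( *%R 'X) (br b c)
  = vsubst (fun r => poly_at (alpha r c) ('X%:P + 'X)) ( *%R 'X%:P) (br a b)
    + vsubst (fun r => poly_at (alpha b r) 'X) ( *%R 'X%:P) (br a c).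
Proof.
case: ext => _ [_ jac].
have sB := @central_partB F R.
have El t x (w : R * F^o) : poly_at (vev (@central_part F R) (ext_br br alpha (x, 0) w)) t
    = poly_at (alpha x w.1) t by rewrite vev_ext_snd.
have Er t (w : R * F^o) x : poly_at (vev (@central_part F R) (ext_br br alpha w (x, 0))) t
    = poly_at (alpha w.1 x) t by rewrite vev_ext_snd.
have alB t x : zmod_morphism (fun r => poly_at (alpha x r) t).
  by move=> y z; rewrite central_ext_addr poly_atB.
have arB t x : zmod_morphism (fun r => poly_at (alpha r x) t).
  by move=> y z; rewrite central_ext_addl poly_atB.
have := vev2_jacobi sB jac (a, 0) (b, 0) (c, 0).
rewrite (eq_vsubst (El _ a) (frefl _)) (eq_vsubst (El _ b) (frefl _)).
rewrite (eq_vsubst (fun w => Er _ w c) (frefl _)).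
rewrite (vsubst_ext_fst _ _ (alB _ a)) ?(vsubst_ext_fst _ _ (alB _ b)); try exact: mulr_zmod.
by rewrite (vsubst_ext_fst _ _ (arB _ c)); last exact: mulr_zmod.
Qed.
End CentralExtension.

Section SesquiExtension.
Variables (F : fieldType) (V : lmodType F).
Variable br : vpoly V -> vpoly V -> vpoly (vpoly V).
Variable alpha : vpoly V -> vpoly V -> {poly F}.
Hypothesis ext : is_central_extension (@vshift F V) br alpha.

(** One statement serves two purposes: chi the coordinate along 𝔠 yields the
    cocycle alpha, and chi = phi on the R-component yields the coboundary
    phi([a_λ b]), without redoing sesquilinearity for the bracket of R. *)
Lemma ext_sesquiform (chi : vpoly V * F^o -> F) : zmod_morphism chi ->
  (forall u, chi (ext_d (@vshift F V) u) = 0) ->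
  sesquiform (fun a b => vev chi (ext_br br alpha (a, 0) (b, 0))).
Proof.
move=> chiB chid; have conf := ext.2.1.
have vB := zmod_morphismD (vevB chiB).
have addl u := zmod_morphismD (zmod_morphism_linear ((ca_bilin conf).1 u)).
have addr u := zmod_morphismD (zmod_morphism_linear ((ca_bilin conf).2 u)).
split=> [a a' b|a b b'|a b|a b].
- by rewrite -vB -addl -[RHS]/(vev chi (ext_br _ _ (a + a', 0 + 0) _)) addr0.
- by rewrite -vB -addr -[RHS]/(vev chi (ext_br _ _ _ (b + b', 0 + 0))) addr0.
- exact: (vev_sesqui_l chiB (a, 0) (b, 0) conf).
- exact: (vev_sesqui_r chiB (a, 0) (b, 0) chid conf).
Qed.

Lemma cocycle_sesquiform : sesquiform alpha.
Proof.
have := ext_sesquiform (@central_partB F (vpoly V)) (fun=> erefl).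
by congr sesquiform; apply/funext => a; apply/funext => b; rewrite vev_ext_snd.
Qed.

Lemma coboundary_sesquiform (phi : vpoly V -> F) : zmod_morphism phi ->
  (forall r, phi (vshift r) = 0) -> sesquiform (fun a b => vev phi (br a b)).
Proof.
move=> phiB phid.
have chiB : zmod_morphism (fun w : vpoly V * F^o => phi w.1) by move=> x y; rewrite phiB.
have := ext_sesquiform chiB (fun w => phid w.1).
congr sesquiform; apply/funext => a; apply/funext => b.
have phiCB : zmod_morphism (fun r => (phi r)%:P) by move=> x y; rewrite phiB raddfB.
exact: (vsubst_ext_fst br alpha (a, 0) (b, 0) phiCB (mulr_zmod 'X)).
Qed.
End SesquiExtension.

(** * The quadratic Leibniz conformal algebra *)

Section Quadratic.
Variables (F : fieldType) (V : lmodType F) (vd br : V -> V -> V).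
Hypothesis hV : is_perm_leibniz vd br.

Let vd0l b : vd 0 b = 0.
Proof. exact: zmod_morphism0 (zmod_morphism_linear ((pl_vd_bilin hV).1 b)). Qed.

Let vd0r a : vd a 0 = 0.
Proof. exact: zmod_morphism0 (zmod_morphism_linear ((pl_vd_bilin hV).2 a)). Qed.

Let br0l b : br 0 b = 0.
Proof. exact: zmod_morphism0 (zmod_morphism_linear ((pl_br_bilin hV).1 b)). Qed.

Let br0r a : br a 0 = 0.
Proof. exact: zmod_morphism0 (zmod_morphism_linear ((pl_br_bilin hV).2 a)). Qed.

Lemma quad_br_const a b : quad_br vd br (vconst a) (vconst b) = quad_base vd br a b.
Proof.
have shB : vmap (@vshift F V) 0 = 0 by apply/zmod_morphism0/vmapB/vshiftB.
rewrite /quad_br vsubst_const ?oppr0 ?raddf0//.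
- by rewrite vsubst_const /= ?shB ?raddf0 ?addr0// /quad_base
    vd0r br0r !raddf0 ?scaler0 !addr0.
- rewrite /vsubst big1// => i _.
  rewrite /quad_base vd0l br0l !raddf0 ?scaler0 !addr0.
  by rewrite iter_fix0//= shB raddf0 addr0.
Qed.

Lemma vsubst_quad_base (N : zmodType) (h : vpoly V -> N) (S : N -> N) a b :
  zmod_morphism h -> zmod_morphism S ->
  vsubst h S (quad_base vd br a b)
  = h (vshift (vconst (vd a b))) + S (h (vconst (vd a b))) *+ 2 + h (vconst (br a b)).
Proof.
move=> hB SB; have h0 := zmod_morphism0 hB; have S0 := zmod_morphism0 SB.
have D := zmod_morphismD (vsubstB hB SB).
by rewrite /quad_base scaler_nat mulr2n !D !vsubst_shift// !vsubst_const// mulr2n.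
Qed.

Lemma vev_quad_br_const (phi : vpoly V -> F) a b : zmod_morphism phi ->
  (forall r, phi (vshift r) = 0) ->
  vev phi (quad_br vd br (vconst a) (vconst b))
  = (2 * phi (vconst (vd a b))) *: 'X + (phi (vconst (br a b)))%:P.
Proof.
move=> phiB phid; rewrite quad_br_const /vev vsubst_quad_base.
- by rewrite phid polyC0 add0r mulrC mul_polyC -scaler_nat scalerA.
- by move=> x y; rewrite phiB raddfB.
- exact: mulr_zmod.
Qed.

(** The three factors arise by combining the coefficient 2μ or 2λ of x ⊢ y in
    the inner bracket with the contribution of ∂(x ⊢ y), on which ∂ acts as λ in
    alpha_λ(a, _), as - (λ + μ) in alpha_(λ+μ)(_, c) and as μ in
    alpha_μ(b, _). *)
Lemma quad_cocycle (alpha : vpoly V -> vpoly V -> {poly F}) :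
  is_central_extension (@vshift F V) (quad_br vd br) alpha ->
  let lam : {poly {poly F}} := 'X%:P in
  let mu : {poly {poly F}} := 'X in
  let alp t a b := poly_at (alpha (vconst a) (vconst b)) t in
  forall a b c : V,
    (lam + 2 * mu) * alp lam a (vd b c) + alp lam a (br b c)
    = (lam - mu) * alp (lam + mu) (vd a b) c + alp (lam + mu) (br a b) c
      + (2 * lam + mu) * alp mu b (vd a c) + alp mu b (br a c).
Proof.
move=> ext lam mu alp a b c.
have [_ _ sl sr] := cocycle_sesquiform ext.
have := ext_cocycle ext (vconst a) (vconst b) (vconst c).
have alrB t x : zmod_morphism (fun r => poly_at (alpha x r) t).
  by move=> y z; rewrite (central_ext_addr ext) poly_atB.
have allB t x : zmod_morphism (fun r => poly_at (alpha r x) t).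
  by move=> y z; rewrite (central_ext_addl ext) poly_atB.
rewrite !quad_br_const// !vsubst_quad_base;
  do ?exact: mulr_zmod; do ?exact: alrB; do ?exact: allB.
rewrite sl !sr (zmod_morphismN (@poly_atB F _)) !poly_atXM -/lam -/mu => jac.
transitivity (lam * alp lam a (vd b c) + mu * alp lam a (vd b c) *+ 2 + alp lam a (br b c)).
  by ring.
by rewrite /alp jac; ring.
Qed.

Lemma quad_cocycle_equivP (alpha alpha' : vpoly V -> vpoly V -> {poly F}) :
  is_central_extension (@vshift F V) (quad_br vd br) alpha ->
  is_central_extension (@vshift F V) (quad_br vd br) alpha' ->
  cocycle_equiv (@vshift F V) (quad_br vd br) alpha alpha' <->
  exists phi : V -> F, scalar phi /\
    forall a b : V,
      alpha (vconst a) (vconst b)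
      = alpha' (vconst a) (vconst b)
        + (2 * phi (vd a b)) *: 'X + (phi (br a b))%:P.
Proof.
move=> ext ext'; split=> [[phi [phil phid eq_phi]]|[phi [phil eq_phi]]].
- exists (fun v => phi (vconst v)); split=> [k u v|a b].
    by rewrite vconst_linear phil.
  rewrite eq_phi -addrA; congr (_ + _).
  by apply: vev_quad_br_const => //; apply: zmod_morphism_linear phil.
- have Phil : scalar (fun f : vpoly V => phi (f 0%N)) by move=> k u v; apply: phil.
  (* The constant coefficient of ∂r is zero, so phi on constant coefficients
     is a morphism to the trivial F[∂]-module. *)
  have phi0 := zmod_morphism0 (zmod_morphism_linear phil).
  exists (fun f : vpoly V => phi (f 0%N)); split=> // a b.
  have PhiB := zmod_morphism_linear Phil.
  apply: (sesquiform_eq (cocycle_sesquiform ext) (sesquiformD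
    (cocycle_sesquiform ext') (coboundary_sesquiform ext PhiB (fun=> phi0)))).
  by move=> x y; rewrite eq_phi vev_quad_br_const// addrA.
Qed.
End Quadratic.

(** * The leading coefficient of a cocycle *)

(** The polynomials p, q, r, s, u, v stand for the values of alpha in the
    functional equation.  Its coefficients in μ^0 and μ^1 are
    λ p + q = λ r + s + 2λ u_0 + v_0 and
    2p = λ r' - r + s' + 2λ u_1 + u_0 + v_1, since f(λ + μ) = f + μ f' + ... .
    For n > 1 the terms in u and v have too small a degree in λ to matter, and
    taking λ^(n+1) in the first and λ^n in the second leaves p_n = r_n and
    2 p_n = n r_n - r_n. *)
Lemma coef_cocycle_top (F : fieldType) (n : nat) (p q r s u v : {poly F}) :
  (1 < n)%N -> (size s <= n.+1)%N -> (size q <= n.+1)%N ->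
  let lam : {poly {poly F}} := 'X%:P in let mu : {poly {poly F}} := 'X in
  (lam + 2 * mu) * poly_at p lam + poly_at q lam
  = (lam - mu) * poly_at r (lam + mu) + poly_at s (lam + mu)
    + (2 * lam + mu) * poly_at u mu + poly_at v mu ->
  (n%:R - 3) * r`_n = 0.
Proof.
move=> n1 sn qn lam mu.
have at_lam f : poly_at f lam = f%:P.
  by rewrite /poly_at comp_polyCr; congr _%:P; apply: comp_polyXr.
have at_mu f i : (poly_at f mu)`_i = (f`_i)%:P.
  by rewrite /poly_at comp_polyXr coef_map.
have at_sum0 f : (poly_at f (lam + mu))`_0 = f.
  by rewrite -horner_coef0 /poly_at horner_comp !hornerE; apply: comp_polyXr.
have at_sum1 f : (poly_at f (lam + mu))`_1 = f^`().
  rewrite -[LHS]mulr1n -[1%N]/(0.+1) -coef_deriv /poly_at deriv_comp deriv_map.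
  by rewrite derivD derivC derivX add0r mulr1 at_sum0.
have out f i : (size f <= n.+1)%N -> (n < i)%N -> f`_i = 0.
  by move=> fn ni; apply/nth_default/(leq_trans fn).
(* With the degree written as n.+2, coefficients of constants and of 'X * f at
   the relevant indices simplify by computation. *)
case: n n1 sn qn out => [|[|n]]// _ sn qn out eq_pol.
have coef_i i := congr1 (fun P : {poly {poly F}} => P`_i) eq_pol.
have := congr1 (fun f : {poly F} => f`_n.+2) (coef_i 1%N).
have := congr1 (fun f : {poly F} => f`_n.+3) (coef_i 0%N).
(* The name k protects the numerals in the goal from simplification. *)
set k := _ * r`_n.+2.
rewrite !at_lam ![(_ + _) * _]mulrDl !mulNr -!mulrA !mul1r /lam /mu -/lam -/mu.
rewrite !(coefD, coefN, coefCM, coefXM, at_sum0, at_sum1, at_mu) /=.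
rewrite !(coefC, coef_deriv, coef0) /= (out _ s) // (out _ q) //.
rewrite !(mul0rn, addr0, subr0) add0r => -> e1.
by rewrite /k mulrBl !mulr_natl (mulrS _ 2) mulr2n e1 [r`_n.+2 + _]addrC addrNK subrr.
Qed.

Theorem theorem4p1 (K : realType) (V : lmodType K[i]) (vd br : V -> V -> V)
    (hV : is_perm_leibniz vd br) :
  (forall (alpha : vpoly V -> vpoly V -> {poly K[i]})
      (n : nat) (al : nat -> V -> V -> K[i]),
    is_central_extension (@vshift K[i] V) (quad_br vd br) alpha ->
    (forall i, (i <= n)%N -> bilinear_for *%R *%R (al i)) ->
    (forall i a b, (n < i)%N -> al i a b = 0) ->
    (forall a b, alpha (vconst a) (vconst b) = \sum_(i < n.+1) al i a b *: 'X^i) ->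
    (exists a b, al n a b != 0) ->
    ((3 < n)%N -> forall a b c, al n (vd a b) c = 0) /\
    ((n <= 3)%N ->
      (forall a b, alpha (vconst a) (vconst b) = \sum_(i < 4) al i a b *: 'X^i) /\
      (let lam : {poly {poly K[i]}} := 'X%:P in
       let mu : {poly {poly K[i]}} := 'X in
       let alp t a b := poly_at (alpha (vconst a) (vconst b)) t in
       forall a b c : V,
         (lam + 2 * mu) * alp lam a (vd b c) + alp lam a (br b c)
         = (lam - mu) * alp (lam + mu) (vd a b) c + alp (lam + mu) (br a b) c
           + (2 * lam + mu) * alp mu b (vd a c) + alp mu b (br a c)))) /\
  (forall alpha alpha' : vpoly V -> vpoly V -> {poly K[i]},
    is_central_extension (@vshift K[i] V) (quad_br vd br) alpha ->
    is_central_extension (@vshift K[i] V) (quad_br vd br) alpha' ->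
    (cocycle_equiv (@vshift K[i] V) (quad_br vd br) alpha alpha' <->
     exists phi : V -> K[i], scalar phi /\
       forall a b : V,
         alpha (vconst a) (vconst b)
         = alpha' (vconst a) (vconst b)
           + (2 * phi (vd a b)) *: 'X + (phi (br a b))%:P)).
Proof.
split=> [alpha n al ext _ al_out alE _|alpha alpha']; last exact: quad_cocycle_equivP.
split=> [n3 a b c|n3].
- have jac := quad_cocycle hV ext a b c.
  have alphaE x y : alpha (vconst x) (vconst y) = \poly_(i < n.+1) al i x y.
    by rewrite alE poly_def.
  have size_alpha x y : (size (alpha (vconst x) (vconst y)) <= n.+1)%N.
    by rewrite alphaE size_poly.
  have /eqP := coef_cocycle_top (ltnW (ltnW n3)) (size_alpha _ _) (size_alpha _ _) jac.
  rewrite alphaE coef_poly ltnSn mulf_eq0 -natrB 1?ltnW// Num.Theory.pnatr_eq0 subn_eq0 leqNgt n3.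
  by move/eqP.
- split; last exact (quad_cocycle hV ext).
  move=> a b; rewrite alE (big_ord_widen 4 (fun i => al i a b *: 'X^i))// big_mkcond.
  by apply: eq_bigr => i _; case: ltnP => // /al_out ->; rewrite scale0r.
Qed.
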